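(* Let $u\in V_0(\Omega)$ be the solution of $a(u,v)=F(v)$ for all $v\in V_0(\Omega)$. Let $\Lambda=\big(\zeta\,\zeta^{*}\max_{i=1,\dots,M}\lambda_{i,m_i+1}\big)^{1/2}$, and for an initial guess $v^0\in V_0(\Omega)$ let the sequence $\{v^j\}_{j\in\mathbb{N}}$ be generated by the abstract iterative MS-GFEM $v^{j+1}=v^j+G(u-v^j)$, $j=0,1,\dots$. Then, for $j=1,2,\dots$, $$\|v^{j+1}-u\|_a\le\Lambda\,\|v^j-u\|_a .$$
   Context: Abstract setting (finite-dimensional case). $V_0(\Omega)$ is a finite-dimensional space of functions on $\Omega$, $a(\cdot,\cdot)$ is a symmetric positive definite bilinear form on $V_0(\Omega)$, and $F\in V_0(\Omega)'$. There are function spaces $\{V(D),V_0(D):D\subset\Omega\}$ indexed by subdomains such that: (i) For any subdomain $D\subset\Omega$, $V_0(D)\subset V(D)$; moreover $V(\Omega)=V_0(\Omega)$. (ii) For $D\subset D^*$ there is a linear operator (zero extension) $E_{D,D^*}:V_0(D)\to V_0(D^* )$ with $\|E_{D,D^*}(u)\|_{V_0(D^* )}=\|u\|_{V_0(D)}$ for all $u\in V_0(D)$; in particular $\|u\|_{V_0(D)}=\|E_{D,\Omega}(u)\|_{V_0(\Omega)}$. One identifies $u\in V_0(D)$ with its zero extension $E_{D,D^*}(u)$. (iii) For $D\subset D^*$ there is a (linear) restriction operator $R_{D^*,D}:V(D^* )\to V(D)$ with $R_{D^*,D}(E_{D,D^*}(u))=u$ for $u\in V_0(D)$, $R_{D^*,D}\circ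 R_{D^{**},D^*}=R_{D^{**},D}$ for $D\subset D^*\subset D^{**}$, and $\|R_{D^*,D}(u)\|_{V(D)}\le\|u\|_{V(D^* )}$ for $u\in V(D^* )$; write $u|_D=R_{D^*,D}(u)$. (iv) For each $D$ there is a bounded symmetric positive semi-definite bilinear form $a_D(\cdot,\cdot)$ on $V(D)$, with $a_\Omega=a$, and for $D\subset D^*$, $a_D(u|_D,v)=a_{D^*}(u,E_{D,D^*}(v))$ for all $u\in V(D^* )$, $v\in V_0(D)$. Set $\|u\|_{a,D}=\sqrt{a_D(u,u)}$ and $\|u\|_a=\|u\|_{a,\Omega}$. Decomposition. $\{\omega_i\}_{i=1}^M$ are overlapping subdomains of $\Omega$ with $\cup_{i=1}^M\omega_i=\Omega$; $\omega_i^*\supset\omega_i$ are oversampling domains with $\operatorname{dist}(\omega_i,\partial\omega_i^*\setminus\partial\Omega)>0$. $\{\chi_i\}_{i=1}^M$ is an abstract partition of unity: bounded linear operators $\chi_i:V(\omega_i)\to V_0(\omega_i)$ with $u=\sum_{i=1}^M\chi_i(u|_{\omega_i})$ for all $u\in V_0(\Omega)$. The coloring constant $\zeta$ of $\{\omega_i\}_{i=1}^M$ is the smallest positive integer such that $\{\omega_i\}_{i=1}^M$ can be partitioned into $\zeta$ classes for which any two distinct members $\omega_{j_1},\omega_{j_2}$ of the same class satisfy $a(u_1,u_2)=0$ for all $u_1\in V_0(\omega_{j_1})$, $u_2\in V_0(\omega_{j_2})$ (it is typically equal to the maximal number of $\omega_i$'s overlapping at any one point). $\zeta^*$ is the coloring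 constant, defined in the same way, of the oversampling domains $\{\omega_i^*\}_{i=1}^M$. Coarse space. Let $V_a(\omega_i^* )=\{u\in V(\omega_i^* ):a_{\omega_i^*}(u,v)=0\ \forall v\in V_0(\omega_i^* )\}$ and consider the eigenproblem: find $\lambda_i\in\mathbb{R}\cup\{+\infty\}$ and $\phi_i\in V_a(\omega_i^* )$ such that $$a_{\omega_i}(\chi_i(\phi_i|_{\omega_i}),\chi_i(v|_{\omega_i}))=\lambda_i\,a_{\omega_i^*}(\phi_i,v)\quad\forall v\in V_a(\omega_i^* ).$$ Let $\lambda_{i,j}$ and $\phi_{i,j}$ denote the $j$-th eigenvalue and eigenfunction, with eigenvalues arranged in decreasing order; the value $+\infty$ is assigned to the kernel of $a_{\omega_i^*}$ on $V_a(\omega_i^* )$, whose elements thus come first. The integers $m_i$ satisfy $m_i\ge l_i$, where $l_i$ is the dimension of the kernel of $a_{\omega_i^*}(\cdot,\cdot)$ on $V_a(\omega_i^* )$. Set $S_{m_i}(\omega_i)=\operatorname{span}\{\phi_{i,1}|_{\omega_i},\dots,\phi_{i,m_i}|_{\omega_i}\}$ and $S_m(\Omega)=\{\sum_{i=1}^M\chi_i(\phi_i):\phi_i\in S_{m_i}(\omega_i)\}$. Map. $\pi_S$ and $\pi_i$ are the $a$-orthogonal projections of $V_0(\Omega)$ onto $S_m(\Omega)$ and $V_0(\omega_i^* )$, respectively; $\widetilde\chi_i:V_0(\omega_i^* )\to V_0(\omega_i^* )$ is given by $\widetilde\chi_i(v)=\chi_i(v|_{\omega_i})$; and $$G(v)=\sum_{i=1}^M\widetilde\chi_i\pi_i(v)+\pi_S\Big(v-\sum_{i=1}^M\widetilde\chi_i\pi_i(v)\Big),\qquad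 v\in V_0(\Omega).$$
   Formalization: Added assumption, without which the bound fails in the abstract setting: for any oversampling domains ω_i* whose spaces V_0(ω_i* ) are mutually a-orthogonal, the sum of the energies ‖u|_{ω_i*}‖²_{a,ω_i*} is at most ‖u‖_a² for all u in V_0(Ω). *)

(* Defs.v *)
From HB Require Import structures.
From mathcomp Require Import all_boot all_order all_algebra sesquilinear.
From mathcomp Require Import all_classical all_reals all_analysis.

Set Implicit Arguments.
Unset Strict Implicit.
Unset Printing Implicit Defensive.

Import Order.TTheory GRing.Theory Num.Theory.

Local Open Scope classical_set_scope.
Local Open Scope ring_scope.

Definition boundary (X : topologicalType) (A : set X) : set X :=
  closure A `\` interior A.

Definition set_dist (R : realType) (X : pseudoMetricType R) (A B : set X) :
  \bar R := ereal_inf [set edist_inf B x | x in A].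

Definition is_norm_on (R : realType) (W : vectType R) (U : {vspace W})
    (N : W -> R) : Prop :=
  [/\ {in U, forall u, N u = 0 -> u = 0},
      {in U, forall u (k : R), N (k *: u) = `|k| * N u} &
      {in U &, forall u v, N (u + v) <= N u + N v}].

(* [X] is the ambient space of [Omega], R^d in the applications.
   Every space [V D] is finite-dimensional.  [V0 D] is a subspace of [V D], so
   operators on [V0 D] are given as linear maps on [V D] that are only
   constrained, and only ever applied, on [V0 D]; in finite dimension every
   linear map on [V0 D] is obtained in this way. *)
Record function_spaces (R : realType) (X : pseudoMetricType R)
    (Omega : set X) := FunctionSpaces {
  subdomain : set (set X);
  subdomain_sub : forall D, subdomain D -> D `<=` Omega;
  subdomain_Omega : subdomain Omega;

  V : set X -> vectType R;
  V0 : forall D, {vspace V D};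
  V0_Omega : V0 Omega = fullv;

  normV : forall D, V D -> R;
  normV0 : forall D, V D -> R;
  normV_norm : forall D, subdomain D -> is_norm_on fullv (@normV D);
  normV0_norm : forall D, subdomain D -> is_norm_on (V0 D) (@normV0 D);

  (* zero extension from [V0 D] to [V0 D'] *)
  ext : forall D D', 'Hom(V D, V D');
  ext_V0 : forall D D', subdomain D -> subdomain D' -> D `<=` D' ->
    {in V0 D, forall u, ext D D' u \in V0 D'};
  ext_norm : forall D D', subdomain D -> subdomain D' -> D `<=` D' ->
    {in V0 D, forall u, normV0 (ext D D' u) = normV0 u};

  (* [res D' D] restricts from the larger [D'] to the smaller [D] *)
  res : forall D' D, 'Hom(V D', V D);
  res_ext : forall D D', subdomain D -> subdomain D' -> D `<=` D' ->
    {in V0 D, forall u, res D' D (ext D D' u) = u};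
  res_comp : forall D D' D'',
    subdomain D -> subdomain D' -> subdomain D'' -> D `<=` D' -> D' `<=` D'' ->
    forall u : V D'', res D' D (res D'' D' u) = res D'' D u;
  res_norm : forall D D', subdomain D -> subdomain D' -> D `<=` D' ->
    forall u : V D', normV (res D' D u) <= normV u;

  a : forall D, {symmetric (V D)};
  a_bounded : forall D, subdomain D ->
    exists C : R, forall u v : V D, `|a D u v| <= C * normV u * normV v;
  a_psd : forall D, subdomain D -> forall u : V D, 0 <= a D u u;
  a_Omega_pd : forall u : V Omega, u != 0 -> 0 < a Omega u u;
  a_res_ext : forall D D', subdomain D -> subdomain D' -> D `<=` D' ->
    forall u : V D', {in V0 D, forall v,
      a D (res D' D u) v = a D' u (ext D D' v)}
}.

Section AbstractSetting.
Variables (R : realType) (X : pseudoMetricType R) (Omega : set X).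
Variable S : function_spaces Omega.

Definition anorm (D : set X) (u : V S D) : R := Num.sqrt (a S D u u).

Record decomposition (M : nat) := Decomposition {
  om : 'I_M -> set X;
  oms : 'I_M -> set X; (* the oversampling domains *)
  om_subdomain : forall i, subdomain S (om i);
  oms_subdomain : forall i, subdomain S (oms i);
  om_cover : \bigcup_(i in [set: 'I_M]) om i = Omega;
  om_oms : forall i, om i `<=` oms i;
  oms_dist : forall i,
    (0 < set_dist (om i) (boundary (oms i) `\` boundary Omega))%E;

  chi : forall i, 'Hom(V S (om i), V S (om i));
  chi_V0 : forall i, (limg (chi i) <= V0 S (om i))%VS;
  chi_bounded : forall i, exists C : R,
    forall u, normV0 (chi i u) <= C * normV u;
  chi_pou : forall u : V S Omega,
    u = \sum_i ext S (om i) Omega (chi i (res S Omega (om i) u))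
}.

Definition a_orthogonal (D1 D2 : set X) : Prop :=
  {in V0 S D1 & V0 S D2, forall u1 u2,
    a S Omega (ext S D1 Omega u1) (ext S D2 Omega u2) = 0}.

Definition colorable (M : nat) (D : 'I_M -> set X) (n : nat) : Prop :=
  exists c : 'I_M -> 'I_n,
    forall i j, i != j -> c i = c j -> a_orthogonal (D i) (D j).

Definition is_coloring_constant (M : nat) (D : 'I_M -> set X) (n : nat) :
    Prop :=
  [/\ (0 < n)%N, colorable D n &
      forall k, (0 < k)%N -> colorable D k -> (n <= k)%N].

(* The energies of an element of [V0 Omega] on subdomains that may share a
   colour add up to at most its total energy.  For an integral form this says
   that such subdomains do not overlap.  The axioms of [function_spaces] alone
   do not give it: they leave [a S D] free on an [a]-complement of [V0 D]. *)
Definition energy_superadditive (M : nat) (D : 'I_M -> set X) : Prop :=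
  forall C : {set 'I_M},
    {in C &, forall i j, i != j -> a_orthogonal (D i) (D j)} ->
    forall u : V S Omega,
      \sum_(i in C) anorm (res S Omega (D i) u) ^+ 2 <= anorm u ^+ 2.

(* The [a]-harmonic space V_a(D). *)
Definition Va (D : set X) : {vspace V S D} := orthov (a S D) (V0 S D).

Definition kerVa (D : set X) : {vspace V S D} :=
  (Va D :&: orthov (a S D) (Va D))%VS.

Section Decomposed.
Variables (M : nat) (P : decomposition M).

Definition eigenpair (i : 'I_M) (lam : \bar R) (phi : V S (oms P i)) : Prop :=
  [/\ phi \in Va (oms P i), phi != 0 &
    match lam with
    | r%:E => phi \notin kerVa (oms P i) /\
        {in Va (oms P i), forall v,
          a S (om P i) (chi P i (res S (oms P i) (om P i) phi))
                       (chi P i (res S (oms P i) (om P i) v))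
          = r * a S (oms P i) phi v}
    | +oo%E => phi \in kerVa (oms P i)
    | -oo%E => False
    end].

(* [phi] and [lam] list the eigenfunctions and the eigenvalues, counted with
   multiplicity, from index 0: the pair (lambda_{i,j+1}, phi_{i,j+1}) is
   [(lam j, phi`_j)].  Past the dimension of V_a there are no eigenvalues left
   and [lam] is 0; in particular [lam] is 0 when V_a is trivial. *)
Definition eigensystem (i : 'I_M) (phi : seq (V S (oms P i)))
    (lam : nat -> \bar R) : Prop :=
  [/\ basis_of (Va (oms P i)) phi,
      forall j, (j < size phi)%N -> eigenpair (lam j) phi`_j,
      forall j, (j < size phi)%N ->
        (lam j = +oo%E <-> (j < \dim (kerVa (oms P i)))%N),
      forall j k, (j <= k)%N -> (k < size phi)%N -> (lam k <= lam j)%E &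
      forall j, (size phi <= j)%N -> lam j = 0%E].

Section CoarseSpace.
Variables (phi : forall i, seq (V S (oms P i))) (m : 'I_M -> nat).

Definition Sloc (i : 'I_M) : {vspace V S (om P i)} :=
  <<[seq res S (oms P i) (om P i) f | f <- take (m i) (phi i)]>>%VS.

Definition Sm : {vspace V S Omega} :=
  (\sum_(i < M) (ext S (om P i) Omega \o chi P i)%VF @: Sloc i)%VS.

End CoarseSpace.

Definition a_projection (W : {vspace V S Omega})
    (p : V S Omega -> V S Omega) : Prop :=
  forall v, p v \in W /\ {in W, forall w, a S Omega (v - p v) w = 0}.

Definition a_projection_loc (i : 'I_M) (p : V S Omega -> V S (oms P i)) :
    Prop :=
  (forall v, p v \in V0 S (oms P i)) /\
  a_projection (ext S (oms P i) Omega @: V0 S (oms P i))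
    (fun v => ext S (oms P i) Omega (p v)).

Definition chit (i : 'I_M) (v : V S (oms P i)) : V S (oms P i) :=
  ext S (om P i) (oms P i) (chi P i (res S (oms P i) (om P i) v)).

Definition G (piS : V S Omega -> V S Omega)
    (pi_ : forall i, V S Omega -> V S (oms P i)) (v : V S Omega) :
    V S Omega :=
  let w := \sum_(i < M) ext S (oms P i) Omega (chit (pi_ i v)) in
  w + piS (v - w).

End Decomposed.
End AbstractSetting.

(* Main.v *)
(* With e = u - v^j, the new error e - G e is the best approximation error in
   the coarse space of sum_i chi_i(h_i), where h_i = e - pi_i e is a-harmonic
   on omega_i^*.  The components of h_i along eigenfunctions with eigenvalue
   above lambda_{i,m_i+1} lie in the coarse space, and chi_i contracts the
   energy of the remaining ones by lambda_{i,m_i+1}.  Colouring the omega_i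
   lets one sum the resulting local energies at the cost of a factor zeta, and
   colouring the omega_i^* bounds the sum of the energies of the h_i by zeta*
   times the energy of e. *)
Require Import Defs.
From mathcomp Require Import all_boot all_order all_algebra sesquilinear.
From mathcomp Require Import all_classical all_reals all_analysis.
From mathcomp Require Import ring lra.
Import Order.TTheory GRing.Theory Num.Theory.
Local Open Scope classical_set_scope.
Local Open Scope ring_scope.

(** * Algebra of symmetric bilinear forms *)

Section SymmetricForms.
Context {R : realType} {W : vectType R} (a : {symmetric W}).

Lemma symmetricC x y : a x y = a y x.
Proof. by rewrite hermC expr0 mul1r. Qed.

Lemma form_sqrD x y : a (x + y) (x + y) = a x x + 2 * a x y + a y y.
Proof. by rewrite linearDr !linearDl /= (symmetricC y x); ring. Qed.

Lemma form_sqrB x y : a (x - y) (x - y) = a x x - 2 * a x y + a y y.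
Proof. by rewrite linearBr !linearBl /= (symmetricC y x); ring. Qed.

Lemma formZZ k l x y : a (k *: x) (l *: y) = k * l * a x y.
Proof. by rewrite linearZl_LR linearZr_LR /= mulrA. Qed.

Lemma form_sum_sum {I J : finType} (Q : pred I) (Q' : pred J)
    (x : I -> W) (y : J -> W) :
  a (\sum_(i | Q i) x i) (\sum_(j | Q' j) y j) =
  \sum_(i | Q i) \sum_(j | Q' j) a (x i) (y j).
Proof.
by rewrite linear_sumlz; apply: eq_bigr => i _; rewrite linear_sumr.
Qed.

End SymmetricForms.

(** * Energy estimates for positive semidefinite forms *)

Section SemidefiniteForms.
Context {R : realType} {W : vectType R} (a : {symmetric W}).
Hypothesis a_ge0 : forall x, 0 <= a x x.

(** Positivity on [x i - x j] gives 2 a(x_i, x_j) <= a(x_i, x_i) + a(x_j, x_j); sum this over all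
    pairs. *)
Lemma form_sum_le {I : finType} (x : I -> W) :
  a (\sum_i x i) (\sum_i x i) <= #|I|%:R * \sum_i a (x i) (x i).
Proof.
pose A := \sum_i a (x i) (x i).
have -> : #|I|%:R * A = \sum_i \sum_j (a (x i) (x i) + a (x j) (x j)) / 2.
  transitivity (\sum_(i : I) (#|I|%:R * a (x i) (x i) + A) / 2); last first.
    apply: eq_bigr => i _; rewrite -mulr_suml big_split /=.
    by rewrite sumr_const mulr_natl.
  rewrite -mulr_suml big_split /= -mulr_sumr -/A sumr_const -mulr_natl.
  by field.
rewrite form_sum_sum; apply: ler_sum => i _; apply: ler_sum => j _.
by have := a_ge0 (x i - x j); rewrite form_sqrB; lra.
Qed.

(** Within one colour the cross terms vanish, so the previous bound is needed only for the [n] sums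
    over colour classes. *)
Lemma form_sum_color_le {I : finType} {n : nat} (c : I -> 'I_n) (x : I -> W) :
  (forall i j, i != j -> c i = c j -> a (x i) (x j) = 0) ->
  a (\sum_i x i) (\sum_i x i) <= n%:R * \sum_i a (x i) (x i).
Proof.
move=> x_orth; rewrite (partition_big c xpredT) //=.
apply: le_trans (form_sum_le _) _.
rewrite card_ord [in leRHS](partition_big c xpredT) //=.
apply: ler_wpM2l => //; apply: ler_sum => k _; rewrite form_sum_sum.
apply: ler_sum => i /eqP cik; rewrite (bigD1 i) ?cik//= big1 ?addr0//.
by move=> j /andP[/eqP cjk ji]; apply: x_orth; rewrite ?cik ?cjk// eq_sym.
Qed.

(** Pythagoras: [p - s] lies in [U], hence is orthogonal to [x - p]. *)
Lemma best_approximation {U : {vspace W}} {x p s : W} : p \in U -> s \in U ->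
  {in U, forall w, a (x - p) w = 0} -> a (x - p) (x - p) <= a (x - s) (x - s).
Proof.
move=> pU sU orth.
have -> : x - s = (x - p) + (p - s) by rewrite addrA subrK.
rewrite [leRHS]form_sqrD (orth (p - s)) ?rpredB// mulr0 addr0.
by rewrite ler_wpDr.
Qed.

(* No orthogonal eigenbasis is needed: as eigenvectors for distinct eigenvalues
   are orthogonal, the form [L a - b] takes at [sum_i c_i x_i] the value of [a]
   at [sum_i sqrt (L - l_i) c_i x_i]. *)
Lemma eigen_sum_le {W' : vectType R} (b : {symmetric W'}) (f : 'Hom(W, W'))
    {I : finType} {Q : pred I} {x : I -> W} {l : I -> R} {L : R} :
    {in Q &, forall i j, b (f (x i)) (f (x j)) = l i * a (x i) (x j)} ->
    {in Q, forall i, l i <= L} ->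
  forall (c : I -> R) (r : W), r = \sum_(i | Q i) c i *: x i ->
  b (f r) (f r) <= L * a r r.
Proof.
move=> bE lL c r rE; rewrite -subr_ge0.
pose d i := Num.sqrt (L - l i).
suff -> : L * a r r - b (f r) (f r) =
    a (\sum_(i | Q i) (d i * c i) *: x i) (\sum_(i | Q i) (d i * c i) *: x i).
  exact: a_ge0.
rewrite rE (linear_sum f) /= !form_sum_sum mulr_sumr -sumrB.
apply: eq_bigr => i Qi; rewrite mulr_sumr -sumrB.
apply: eq_bigr => j Qj.
rewrite !(linearZ_LR f) /= !formZZ bE//.
have d2 k : Q k -> d k * d k = L - l k.
  by move=> Qk; rewrite -expr2 sqr_sqrtr// subr_ge0 lL.
have [lij|lij] := eqVneq (l i) (l j).
  have := d2 i Qi; rewrite /d -lij => d2i.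
  transitivity (Num.sqrt (L - l i) * Num.sqrt (L - l i) * (c i * c j * a (x i) (x j))).
    by rewrite d2i; ring.
  by ring.
have a0 : a (x i) (x j) = 0.
  have bC : b (f (x i)) (f (x j)) = b (f (x j)) (f (x i)).
    by rewrite hermC expr0 mul1r.
  move: bC; rewrite !bE// (symmetricC a (x j)) => /eqP.
  by rewrite -subr_eq0 -mulrBl mulf_eq0 subr_eq0 (negPf lij) => /eqP.
by rewrite a0; ring.
Qed.

End SemidefiniteForms.

(** * Transfer between subdomains, harmonic defects and spectral truncation *)

Section Subdomains.
Context {R : realType} {X : pseudoMetricType R} {Omega : set X}.
Context {S : function_spaces Omega}.

Lemma a_Omega_ge0 (x : V S Omega) : 0 <= a S Omega x x.
Proof. exact/a_psd/subdomain_Omega. Qed.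

Lemma anorm_sqr (D : set X) (x : V S D) :
  subdomain S D -> anorm x ^+ 2 = a S D x x.
Proof. by move=> sD; rewrite sqr_sqrtr ?a_psd. Qed.

Lemma form_Omega_inj (x y : V S Omega) :
  (forall w, a S Omega w x = a S Omega w y) -> x = y.
Proof.
move=> xy; apply/eqP; rewrite -subr_eq0; apply/negPn/negP => /a_Omega_pd.
by rewrite linearBr /= xy subrr ltxx.
Qed.

(* Transitivity of zero extension is not an axiom of [function_spaces]; towards
   [Omega] it follows from duality with restriction, [a] being definite. *)
Lemma ext_trans (D D' : set X) (x : V S D) :
    subdomain S D -> subdomain S D' -> D `<=` D' -> x \in V0 S D ->
  ext S D' Omega (ext S D D' x) = ext S D Omega x.
Proof.
move=> sD sD' DD' x0; apply: form_Omega_inj => w.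
have sO := subdomain_Omega S; have DO := subdomain_sub sD.
have D'O := subdomain_sub sD'.
rewrite -a_res_ext ?ext_V0// -a_res_ext// -a_res_ext//.
by rewrite res_comp.
Qed.

Lemma a_ext (D : set X) (x : V S D) : subdomain S D -> x \in V0 S D ->
  a S Omega (ext S D Omega x) (ext S D Omega x) = a S D x x.
Proof.
move=> sD x0; have sO := subdomain_Omega S; have DO := subdomain_sub sD.
by rewrite -a_res_ext// res_ext.
Qed.

Context {M : nat} {P : decomposition S M}.

Section LocalDefect.
Context {i : 'I_M} {p : V S Omega -> V S (oms P i)}.
Hypothesis hp : a_projection_loc p.
Variable e : V S Omega.

Let h := res S Omega (oms P i) e - p e.

Lemma local_defect_Va : h \in Va S (oms P i).
Proof.
have sD := oms_subdomain P i; have sO := subdomain_Omega S.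
have DO := subdomain_sub sD.
have [pV0 /(_ e)[_ p_orth]] := hp.
apply/mem_orthovP => w w0; rewrite linearBl /= a_res_ext//.
(* Writing [p e] as the restriction of its own extension lets both terms of [h] be paired on
   [Omega], where the projection property applies. *)
rewrite -(res_ext sD sO DO (pV0 e)) a_res_ext//.
by have := p_orth _ (memv_img (ext S _ _) w0); rewrite linearBl.
Qed.

(** The restriction of [e] splits into the harmonic [h] and [p e] in [V0], which are orthogonal. *)
Lemma local_defect_energy :
  a S (oms P i) h h <= anorm (res S Omega (oms P i) e) ^+ 2.
Proof.
have sD := oms_subdomain P i.
have hV0 : a S (oms P i) h (p e) = 0.
  by move/mem_orthovP: local_defect_Va; apply; case: hp.
rewrite anorm_sqr//; have -> : res S Omega (oms P i) e = h + p e by rewrite subrK.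
by rewrite [leRHS]form_sqrD hV0 mulr0 addr0 ler_wpDr// a_psd.
Qed.

End LocalDefect.

(** Take for [s] the part of [h] along eigenvalues above [lam k]. Splitting by eigenvalue rather
    than by index keeps equal eigenvalues together, so the two parts are orthogonal although the
    eigenbasis need not be. *)
Lemma spectral_approximation {i : 'I_M} {f : seq (V S (oms P i))}
    {lam : nat -> \bar R} {k : nat} {L : R} {h : V S (oms P i)} :
    eigensystem f lam -> (\dim (kerVa S (oms P i)) <= k)%N ->
    0 <= L -> fine (lam k) <= L -> h \in Va S (oms P i) ->
  exists2 s, s \in <<take k f>>%VS &
    anorm (chi P i (res S (oms P i) (om P i) (h - s))) ^+ 2
      <= L * a S (oms P i) h h.
Proof.
move=> [f_basis f_eig lam_oo lam_mono lam_out] ker_k L_ge0 lam_L hVa.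
have sD := oms_subdomain P i.
have pos (x : V S (oms P i)) := a_psd sD x.
pose n := size f; pose x (j : 'I_n) := f`_j.
pose Q := [pred j : 'I_n | (lam j <= lam k)%E].
pose c (j : 'I_n) : R := coord (in_tuple f) j h.
have hE : h = \sum_j c j *: x j.
  by apply: coord_span; rewrite (span_basis f_basis).
have fVa (j : 'I_n) : x j \in Va S (oms P i) by case: (f_eig j (ltn_ord j)).
pose r := \sum_(j | Q j) c j *: x j.
pose s := \sum_(j | ~~ Q j) c j *: x j.
have hrs : h = r + s by rewrite hE (bigID Q).
(* Infinite eigenvalues sit exactly at the indices below the kernel dimension, and past the basis
   [lam] is 0. *)
have lamk_fin : lam k \is a fin_num.
  have [kn|/lam_out->//] := ltnP k n.
  have [_ _] := f_eig k kn; case E: (lam k) => [l||]//= _.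
  by have := (lam_oo k kn).1 E; rewrite ltnNge ker_k.
have Qfin j : Q j -> exists l : R, lam j = l%:E.
  rewrite /= => jk; have [_ _] := f_eig j (ltn_ord j).
  case E: (lam j) => [l||]//=; first by exists l.
  by move: jk; rewrite E leye_eq => /eqP kE; rewrite kE in lamk_fin.
have bE : {in Q &, forall j j',
    a S (om P i) (chi P i (res S (oms P i) (om P i) (x j)))
                 (chi P i (res S (oms P i) (om P i) (x j'))) =
    fine (lam j) * a S (oms P i) (x j) (x j')}.
  move=> j j' /Qfin[l jl] _; have [_ _] := f_eig j (ltn_ord j).
  by rewrite jl => -[_ ->].
have lL : {in Q, forall j : 'I_n, fine (lam j) <= L}.
  move=> j Qj; have [l jl] := Qfin j Qj; apply: le_trans lam_L.
  by rewrite fine_le// jl.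
(* Across the split, either [x j'] is in the kernel, or both eigenvalues are finite and distinct and
   symmetry of the two forms forces orthogonality. *)
have rs0 : a S (oms P i) r s = 0.
  rewrite form_sum_sum big1// => j Qj; rewrite big1// => j' nQj'.
  rewrite formZZ; suff -> : a S (oms P i) (x j) (x j') = 0 by rewrite mulr0.
  have [_ _] := f_eig j (ltn_ord j); have [l jl] := Qfin j Qj.
  rewrite jl => -[_ jE]; have [_ _] := f_eig j' (ltn_ord j').
  case j'l: (lam j') => [l'||]//; last first.
    rewrite memv_cap => /andP[_ /mem_orthovP j'_orth].
    by rewrite symmetricC; exact: j'_orth.
  move=> [_ /(_ _ (fVa j)) j'E]; move: (jE _ (fVa j')).
  rewrite symmetricC j'E (symmetricC _ (f`_j')) => /eqP.
  rewrite -subr_eq0 -mulrBl mulf_eq0 subr_eq0 => /orP[/eqP ll'|/eqP//].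
  by case/negP: nQj'; rewrite /Q /= j'l ll' -jl.
exists s.
  apply: memv_suml => j nQj; apply: memvZ; apply: memv_span.
  (* Eigenvalues decrease, so one above [lam k] has index below [k]. *)
  have jk : (j < k)%N.
    rewrite ltnNge; apply: contra nQj => kj.
    by rewrite inE lam_mono.
  rewrite /x -(nth_take 0 jk) mem_nth// size_take.
  by case: ifP.
have {}hs : h - s = r by rewrite hrs addrK.
apply: le_trans (_ : L * a S (oms P i) r r <= _).
  rewrite anorm_sqr ?hs; last exact: om_subdomain.
  pose g := (chi P i \o res S (oms P i) (om P i))%VF.
  have gE z : chi P i (res S (oms P i) (om P i) z) = g z by rewrite comp_lfunE.
  rewrite gE; apply: (eigen_sum_le _ pos (a S (om P i)) g _ lL c r erefl).
  by move=> j j' Qj Qj'; rewrite -!gE bE.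
by rewrite ler_wpM2l// hrs [leRHS]form_sqrD rs0 mulr0 addr0 ler_wpDr.
Qed.

End Subdomains.

Theorem proposition4p10 (R : realType) (X : pseudoMetricType R)
    (Omega : set X) (S : function_spaces Omega)
    (M : nat) (hM : (0 < M)%N) (P : decomposition S M)
    (zeta zetas : nat)
    (hzeta : is_coloring_constant S (om P) zeta)
    (hzetas : is_coloring_constant S (oms P) zetas)
    (henergy : energy_superadditive S (oms P))
    (phi : forall i, seq (V S (oms P i))) (lam : 'I_M -> nat -> \bar R)
    (heig : forall i, eigensystem (phi i) (lam i))
    (m : 'I_M -> nat) (hm : forall i, (\dim (kerVa S (oms P i)) <= m i)%N)
    (piS : V S Omega -> V S Omega) (hpiS : a_projection (Sm phi m) piS)
    (pi_ : forall i, V S Omega -> V S (oms P i))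
    (hpi : forall i, a_projection_loc (pi_ i))
    (F : {scalar (V S Omega)})
    (u : V S Omega) (hu : forall w, a S Omega u w = F w)
    (v : nat -> V S Omega)
    (hv : forall j, v j.+1 = v j + G piS pi_ (u - v j)) :
  let Lambda := Num.sqrt
    (zeta%:R * zetas%:R * \big[Num.max/0]_(i < M) fine (lam i (m i))) in
  forall j, (1 <= j)%N -> anorm (v j.+1 - u) <= Lambda * anorm (v j - u).
Proof.
move=> Lambda j _; rewrite /Lambda.
set L := \big[Num.max/0]_(i < M) _.
have L_ge0 : 0 <= L.
  by rewrite /L; elim/big_rec: _ => // i x _ x0; rewrite le_max x0 orbT.
have lamL i : fine (lam i (m i)) <= L by rewrite /L; exact: le_bigmax.
pose e := u - v j.
have sO := subdomain_Omega S.
have aN (x y : V S Omega) : a S Omega (x - y) (x - y) = a S Omega (y - x) (y - x).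
  by rewrite -[y - x]opprB hnormN.
(* The new error v_{j+1} - u is -(e - G e), so it suffices to compare squared energies. *)
suff GE : a S Omega (e - G piS pi_ e) (e - G piS pi_ e) <=
    zeta%:R * zetas%:R * L * a S Omega e e.
  have -> : anorm (v j.+1 - u) = anorm (e - G piS pi_ e).
    rewrite /anorm aN; congr (Num.sqrt (a S Omega _ _)).
      by rewrite hv opprD addrA.
    by rewrite hv opprD addrA.
  have -> : anorm (v j - u) = anorm e by rewrite /anorm aN.
  rewrite /anorm -sqrtrM ?mulr_ge0//.
  by rewrite ler_wsqrtr.
pose h i := res S Omega (oms P i) e - pi_ i e.
have hVa i : h i \in Va S (oms P i) by exact: local_defect_Va.
have [s sS sE] : exists2 s : forall i, V S (oms P i),
    forall i, s i \in <<take (m i) (phi i)>>%VS &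
    forall i, anorm (chi P i (res S (oms P i) (om P i) (h i - s i))) ^+ 2
      <= L * a S (oms P i) (h i) (h i).
  have s_ex i := spectral_approximation (heig i) (hm i) L_ge0 (lamL i) (hVa i).
  exists (fun i => s2val (cid2 (s_ex i))) => i.
    exact: (s2valP (cid2 (s_ex i))).
  exact: (s2valP' (cid2 (s_ex i))).
pose loc i z := ext S (om P i) Omega (chi P i (res S (oms P i) (om P i) z)).
pose w := \sum_i ext S (oms P i) Omega (chit (pi_ i e)).
have chiV0 i z : chi P i z \in V0 S (om P i).
  by apply: (subvP (chi_V0 P i)); apply: memv_img; apply: memvf.
have omD i := om_subdomain P i; have omsD i := oms_subdomain P i.
have omoms i : om P i `<=` oms P i by exact: om_oms.
have omO i := subdomain_sub (omD i); have omsO i := subdomain_sub (omsD i).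
(* Expand [e] by the partition of unity and restrict to each [om P i] through [oms P i], so that the
   terms of [w] subtract one by one. *)
have ew : e - w = \sum_i loc i (h i).
  rewrite {1}[e](chi_pou P) -sumrB; apply: eq_bigr => i _.
  rewrite /chit (ext_trans _ _ _ (omD i) (omsD i) (omoms i)) ?chiV0//.
  rewrite -(res_comp (omD i) (omsD i) sO (omoms i) (omsO i)).
  by rewrite -!linearB.
have sSm : \sum_i loc i (s i) \in Sm phi m.
  apply: memv_sumr => i _; rewrite /loc -comp_lfunE; apply: memv_img.
  by rewrite /Sloc -limg_span memv_img.
(* The new error is the projection error of [e - w], hence at most its distance to the coarse
   element built from the [s i]. *)
have -> : e - G piS pi_ e = (e - w) - piS (e - w) by rewrite /G opprD addrA.
have [pS p_orth] := hpiS (e - w).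
apply: le_trans (best_approximation _ a_Omega_ge0 pS sSm p_orth) _.
have -> : e - w - \sum_i loc i (s i) = \sum_i loc i (h i - s i).
  by rewrite ew -sumrB; apply: eq_bigr => i _; rewrite /loc -!linearB.
have [_ [c c_orth] _] := hzeta; have [_ [cs cs_orth] _] := hzetas.
apply: le_trans (form_sum_color_le _ a_Omega_ge0 c _ _) _.
  by move=> i i' ii' cii'; apply: (c_orth i i' ii' cii'); apply: chiV0.
rewrite -!mulrA ler_wpM2l// mulrCA.
apply: (@le_trans _ _ (L * \sum_i a S (oms P i) (h i) (h i))).
  rewrite mulr_sumr; apply: ler_sum => i _.
  by have := sE i; rewrite anorm_sqr// a_ext ?chiV0.
rewrite ler_wpM2l//.
apply: (@le_trans _ _ (\sum_i anorm (res S Omega (oms P i) e) ^+ 2)).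
  by apply: ler_sum => i _; apply: local_defect_energy.
(* Each colour class of oversampling domains carries at most the full energy of [e], and there are
   [zetas] classes. *)
rewrite (partition_big cs xpredT) //=.
apply: (@le_trans _ _ (\sum_(k < zetas) anorm e ^+ 2)).
  apply: ler_sum => k _.
  rewrite -big_set /=; apply: (henergy) => i i'.
  rewrite !inE => /eqP ik /eqP i'k ii'.
  by apply: cs_orth => //; apply: val_inj; rewrite /= ik.
by rewrite sumr_const card_ord anorm_sqr// [leRHS]mulr_natl.
Qed.
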